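(* Let $V$ be a reflexive Banach space, and let $F \colon V \to \mathbb{R}$ be a G\^{a}teaux differentiable, convex functional that is semicoercive with respect to a seminorm $|\cdot|$ on $V$. Let $V = \sum_{j=1}^N V_j$ with closed subspaces $V_j$, and let $u \in V$ be a minimizer of $F$ over $V$. Suppose that: (Local smoothness) for some $q > 1$ and every $j \in \{1,\dots,N\}$: for any $|\cdot|$-bounded convex subset $K \subset V$ and any $\|\cdot\|$-bounded convex subset $K_j \subset V_j$ with $0 \in K_j$, $\sup_{v \in K,\, w_j \in K_j} d_j(w_j;v)/\|w_j\|^q < \infty$; (Sharpness) for some $p>1$: for any $|\cdot|$-bounded convex subset $K \subset V$ with $u \in K$, $$\mu_K := p \inf_{v \in K} \frac{F(v)-F(u)}{|v-u|^p} > 0 .$$ Let $\{u^{(n)}\}_{n\ge 0}$ be a sequence generated by the parallel subspace correction method with initial iterate $u^{(0)} \in V$ and step size $\tau \in (0,\tau_0]$, and let $\zeta_n = F(u^{(n)})-F(u)$ for $n \ge 0$. Then: (a) If $p = q$, then $$\zeta_n \leq \left( 1- \tau \left( 1 - \frac{1}{q} \right) \min \left\{ 1, \frac{\mu_{K_0}}{q C_{K_0}} \right\}^{\frac{1}{q-1}} \right)^n \zeta_0, \quad n \geq 0.$$ (b) If $p > q$: when $\zeta_0 > \left( \frac{p}{\mu_{K_0}} \right)^{\frac{q}{p-q}} C_{K_0}^{\frac{p}{p-q}}$, we have $$\zeta_1 \leq \left(1 - \tau \left( 1 - \frac{1}{q} \right) \right) \zeta_0 ;$$ otherwise, $$\zeta_n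 \leq \frac{C}{\left( n + (C/\zeta_0)^{1/\beta} \right)^{\beta}}, \quad n \geq 0,$$ where $$\beta = \frac{p(q-1)}{p-q}, \qquad C = \left( \frac{pq}{(p-q) \tau} \right)^{\frac{p(q-1)}{p-q}} \left( \frac{p}{\mu_{K_0}} \right)^{\frac{q}{p-q}} C_{K_0}^{\frac{p}{p-q}} .$$
   Context: Semicoercivity with respect to a seminorm: $F$ is semicoercive with respect to $|\cdot|$ if $|\cdot|$ is a continuous seminorm on $V$ such that, with $\ker|\cdot| = \{v \in V : |v| = 0\}$, there is a constant $C'>0$ with $\inf_{\phi \in \ker|\cdot|} \|v+\phi\| \le C'|v|$ for all $v \in V$; $F(v)=F(v+\phi)$ for all $v \in V$, $\phi \in \ker|\cdot|$; and $F(v) \to \infty$ as $|v| \to \infty$. Write $\mathcal{N} = \ker|\cdot|$. Local functionals: for $v \in V$, $w_j \in V_j$, set $F_j(w_j;v) = F(v+w_j)$ and $d_j(w_j; v) = F_j(w_j;v) - F(v) - \langle F'(v), w_j\rangle$, where $F'(v) \in V^*$ is the G\^{a}teaux derivative and $\langle\cdot,\cdot\rangle$ the duality pairing. $\tau_0$: $\tau_0$ is the maximum of all $\tau > 0$ such that $(1-\tau N)F(v) + \tau\sum_{j=1}^N F(v+w_j) \ge F\bigl(v+\tau\sum_{j=1}^N w_j\bigr)$ for all $v \in V$ and $w_j \in V_j$; this inequality then holds for every $\tau \in (0,\tau_0]$. Parallel subspace correction method: given $u^{(0)} \in V$ and $\tau \in (0,\tau_0]$, for $n = 0,1,2,\dots$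 choose $w_j^{(n+1)} \in \arg\min_{w_j \in V_j} F_j(w_j;u^{(n)})$ for each $j \in \{1,\dots,N\}$ and set $u^{(n+1)} = u^{(n)} + \tau\sum_{j=1}^N w_j^{(n+1)}$. Constants: $K_0 = \{v \in V : F(v) \le F(u^{(0)})\}$, and for a set $K \subset V$, $$C_K = q \sup_{v,\, v+w \in K}\ \inf_{\phi \in \mathcal{N}}\ \inf_{\sum_{j=1}^N w_j = w+\phi,\ w_j \in V_j} \frac{\sum_{j=1}^N d_j(w_j;v)}{|w|^q}.$$ Conventions: quotients $0/0$ are $0$ when they are arguments of a supremum and $+\infty$ when they are arguments of an infimum (as in $\mu_K$); in $C_K$ the quotient $\bigl(\inf_\phi\inf_{(w_j)}\sum_j d_j(w_j;v)\bigr)/|w|^q$ is regarded as the argument of the supremum (so it is $0$ when $|w|=0$). If $\zeta_0 = 0$, the last bound in (b) is read as $\zeta_n = 0$. *)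

(* Defs.v *)
From HB Require Import structures.
From mathcomp Require Import all_boot all_order all_algebra.
From mathcomp Require Import all_classical all_reals all_analysis.

Set Implicit Arguments.
Unset Strict Implicit.
Unset Printing Implicit Defensive.

Import Order.TTheory GRing.Theory Num.Theory.
Import numFieldNormedType.Exports.

Local Open Scope classical_set_scope.
Local Open Scope ring_scope.

(** * Topological dual and reflexivity *)
Section Dual.
Context {R : realType} (V : normedModType R).

Definition dual : set (V -> R) := [set f : V -> R | scalar f /\ continuous f].

Definition dual_norm (f : V -> R) : R :=
  sup [set `|f v| | v in [set v : V | `|v| <= 1]].

(* Only the values of [Phi] on [dual] matter. *)
Definition bidual : set ((V -> R) -> R) :=
  [set Phi |
    (forall (a : R) (f g : V -> R), dual f -> dual g ->
       Phi (fun v => a * f v + g v) = a * Phi f + Phi g) /\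
    exists M : R, forall f, dual f -> `|Phi f| <= M * dual_norm f].

Definition reflexive_space : Prop :=
  forall Phi, bidual Phi -> exists v : V, forall f, dual f -> Phi f = f v.

End Dual.

(** * Functionals and seminorms *)
Section Functionals.
Context {R : realType} {V : normedModType R}.
Implicit Types (F sn : V -> R) (u v w phi : V) (K W : set V).

Definition gateaux_derivative F v : V -> R := fun w => 'D_w F v.

Definition gateaux_differentiable F : Prop :=
  forall v, (forall w, derivable F v w) /\ dual (gateaux_derivative F v).

Definition minimizer F u : Prop := forall v, F u <= F v.

Definition seminorm sn : Prop :=
  (forall v w, sn (v + w) <= sn v + sn w) /\
  (forall (a : R) v, sn (a *: v) = `|a| * sn v).

Definition ker_seminorm sn : set V := [set v | sn v = 0].

Definition semicoercive F sn : Prop :=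
  [/\ seminorm sn /\ continuous sn,
      exists2 C' : R, 0 < C' & forall v,
        inf [set `|v + phi| | phi in ker_seminorm sn] <= C' * sn v,
      forall v phi, ker_seminorm sn phi -> F v = F (v + phi)
    & forall A : R, exists M : R, forall v, M <= sn v -> A <= F v].

Definition seminorm_bounded sn K : Prop :=
  exists M : R, forall v, K v -> sn v <= M.

Definition convex_subset K : Prop := convex_set (K : set (convex_lmodType V)).

Definition sublevel F (c : R) : set V := [set v | F v <= c].

End Functionals.

(** * Quotients with a prescribed value of 0/0 *)

(* Away from 0/0 this is the division of [\bar R], where [x / 0 = +oo] for
   [0 < x] and [x / +oo = 0] for finite [x]. *)
Definition quotient_with {R : realType} (z x y : \bar R) : \bar R :=
  (if (x == 0) && (y == 0) then z else x / y)%E.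

Definition quotient_sup {R : realType} := @quotient_with R 0%E.
Definition quotient_inf {R : realType} := @quotient_with R +oo%E.

(** * Space decompositions and the parallel subspace correction method *)
Section SubspaceCorrection.
Context {R : realType} {V : normedModType R} {N : nat}.
Implicit Types (F sn : V -> R) (u v w phi : V) (K : set V) (Vs : 'I_N -> set V)
  (ws : 'I_N -> V).

Definition subspace_family Vs ws : Prop := forall j, Vs j (ws j).

Definition space_decomposition Vs : Prop :=
  (forall j, GRing.submod_closed (mem (Vs j)) /\ closed (Vs j)) /\
  forall v, exists2 ws, subspace_family Vs ws & v = \sum_j ws j.

(* $F_j(w_j;v)$ and $d_j(w_j;v)$: the index $j$ enters only through
   $w_j \in V_j$. *)
Definition local_functional F w v : R := F (v + w).

Definition local_distance F w v : R :=
  local_functional F w v - F v - gateaux_derivative F v w.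

Definition local_smoothness F sn Vs (q : R) : Prop :=
  forall (j : 'I_N) (K Kj : set V),
    seminorm_bounded sn K -> convex_subset K ->
    Kj `<=` Vs j -> bounded_set Kj -> convex_subset Kj -> Kj 0 ->
    (ereal_sup [set x | exists v w, [/\ K v, Kj w &
        x = quotient_sup (local_distance F w v)%:E (`|w| `^ q)%:E]] < +oo)%E.

Definition sharpness_constant F sn u (p : R) K : \bar R :=
  (p%:E * ereal_inf [set quotient_inf (F v - F u)%:E (sn (v - u) `^ p)%:E
                    | v in K])%E.

Definition sharpness F sn u (p : R) : Prop :=
  forall K, seminorm_bounded sn K -> convex_subset K -> K u ->
    (0 < sharpness_constant F sn u p K)%E.

Definition decomposition_energy F sn Vs v w : \bar R :=
  ereal_inf [set
    ereal_inf [set (\sum_j local_distance F (ws j) v)%:E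
              | ws in [set ws | subspace_family Vs ws /\
                                \sum_j ws j = w + phi]]
    | phi in ker_seminorm sn].

(* $C_K$ *)
Definition stability_constant F sn Vs (q : R) K : \bar R :=
  (q%:E * ereal_sup [set x | exists v w, [/\ K v, K (v + w)%R &
     x = quotient_sup (decomposition_energy F sn Vs v w)
                      (sn w `^ q)%:E]])%E.

Definition admissible_step F Vs : set R :=
  [set tau : R | 0 < tau /\
    forall v ws, subspace_family Vs ws ->
      F (v + tau *: \sum_j ws j) <=
      (1 - tau * N%:R) * F v + tau * \sum_j F (v + ws j)].

Definition max_admissible_step F Vs (tau0 : R) : Prop :=
  admissible_step F Vs tau0 /\ ubound (admissible_step F Vs) tau0.

Definition local_minimizer F Vs v (j : 'I_N) : set V :=
  [set w | Vs j w /\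
    forall w', Vs j w' -> local_functional F w v <= local_functional F w' v].

Definition parallel_subspace_correction F Vs (tau : R) (us : nat -> V) : Prop :=
  forall n, exists2 ws,
    (forall j, local_minimizer F Vs (us n) j (ws j))
    & us n.+1 = us n + tau *: \sum_j ws j.

End SubspaceCorrection.

(* Main.v *)
Require Import Defs.
From HB Require Import structures.
From mathcomp Require Import all_boot all_order all_algebra.
From mathcomp Require Import all_classical all_reals all_analysis.
From mathcomp Require Import ring lra.

Set Implicit Arguments.
Unset Strict Implicit.
Unset Printing Implicit Defensive.

Import Order.TTheory GRing.Theory Num.Theory.
Import numFieldNormedType.Exports.

Local Open Scope classical_set_scope.
Local Open Scope ring_scope.

(** Write [z n = F (us n) - F u] and [s n = sn (us n - u)].  The whole proof
    rests on one inequality: for every [t] in [[0, 1]],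
    [z (n+1) <= z n - tau * (t * z n - t ^ q * (CK / q) * s n ^ q)].

    It comes from comparing the computed local minimizers with the pieces of an
    arbitrary decomposition of [w + phi], where [w = t (u - us n)] and [phi] is
    in the kernel of the seminorm.  Admissibility of the step size bounds
    [F (us (n+1))] by an affine combination of [F (us n)] and the values
    [F (us n + ws j)].  Replacing the minimizers by the pieces, the increments
    [F (us n + ws j) - F (us n)] sum up to [F'(us n) w] plus the sum of the local
    distances.  Convexity gives [F'(us n) w <= - t * z n], and the infimum of that
    sum of local distances over all decompositions is at most
    [(CK / q) * sn w ^ q] ([parallel_step_decrease]).

    Sharpness bounds [s n] by a power of [z n], and choosing [t] close to
    optimally turns the inequality into a recursion for [z] alone:
    geometric when [p = q] ([linear_rate]), and
    [z (n+1) <= z n - kappa * z n ^ (1 + 1 / beta)] when [q < p], provided the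
    optimal [t] is at most [1] ([sublinear_rate]); above the threshold the
    optimal [t] exceeds [1] and [t = 1] is used instead
    ([first_step_above_threshold]).

    The argument needs [CK] to be finite ([stability_constant_fin]); for
    [CK = +oo] the quotient in the last bound would be [+oo / +oo], which
    evaluates to [0].  Finiteness is where completeness of
    the space enters.  The open mapping theorem for the sum map from the product
    of the closed subspaces onto [V] provides decompositions whose pieces are
    controlled by the norm of the sum ([stable_decomposition]); semicoercivity
    lets one choose [phi] so that the norm of [w + phi] is controlled by [sn w];
    local smoothness then bounds the local distances of the pieces. *)

(** * Convex functionals and their Gateaux derivatives *)

Section GateauxConvex.
Context {R : realType} {V : normedModType R}.
Implicit Types (F sn : V -> R) (v w phi : V).

Lemma convex_functionP F x y (t : R) : convex_function [set: V] F ->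
  0 <= t -> t <= 1 ->
  F (t *: x + (1 - t) *: y) <= t * F x + (1 - t) * F y.
Proof.
move=> cF t0 t1; have t01 : Itv.spec (@Itv.num_sem R) (Itv.Real `[0%Z, 1%Z]) t.
  by apply/and3P; split; rewrite ?bnd_simp ?num_real.
by have := cF (Itv.Def t01) x y (in_setT _) (in_setT _).
Qed.

(** The slopes of [F] along the line through [v] in direction [w] are monotone.
    Both one-sided difference quotients are compared with the slope between
    [v] and [v + w], because the derivative is a two-sided limit. *)
Lemma gateaux_le_increment F v w : convex_function [set: V] F ->
  derivable F v w -> gateaux_derivative F v w <= F (v + w) - F v.
Proof.
move=> cF dF; apply: limr_le => //.
near=> h.
have h0 : h != 0 by near: h; exact: nbhs_dnbhs_neq.
have hlt1 : `|h| < 1.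
  near: h; apply: dnbhs0_lt; exact: ltr01.
rewrite /GRing.scale/=.
have [hpos|hneg|/eqP] := ltgtP 0 h; last by rewrite eq_sym (negPf h0).
  rewrite gtr0_norm// in hlt1.
  rewrite ler_pdivrMl//.
  have := convex_functionP (v + w) v cF (ltW hpos) (ltW hlt1).
  have -> : h *: (v + w) + (1 - h) *: v = h *: w + v.
    rewrite scalerDr scalerBl scale1r [h *: v + _]addrC -addrA.
    by congr (_ + _); rewrite addrC subrK.
  set a := F _; set b := F _; set c := F _; nra.
pose s := - h; have s0 : 0 < s by rewrite oppr_gt0.
rewrite -[h]opprK -/s invrN mulNr lerNl ler_pdivlMl// mulrN.
(* [v] lies between [v - s w] and [v + w], with weight [t] on the former. *)
pose t := (1 + s)^-1.
have s1 : 0 < 1 + s by lra.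
have t0 : 0 <= t by rewrite invr_ge0 ltW.
have t1 : t <= 1 by rewrite invf_le1// ; lra.
have := convex_functionP (- s *: w + v) (v + w) cF t0 t1.
have -> : t *: (- s *: w + v) + (1 - t) *: (v + w) = v.
  rewrite [v + w]addrC !scalerDr scalerA addrACA -!scalerDl.
  rewrite (_ : t * - s + (1 - t) = 0); last by rewrite /t; field; rewrite gt_eqF.
  by rewrite scale0r add0r addrC subrK scale1r.
set a := F _; set b := F _; set c := F _ => le_a.
have : (1 + s) * a <= b + s * c.
  have <- : (1 + s) * (t * b + (1 - t) * c) = b + s * c.
    by rewrite /t; field; rewrite gt_eqF.
  by rewrite ler_wpM2l// ltW.
by lra.
Unshelve. all: by end_near.
Qed.

Lemma gateaux_derivativeZ F v (t : R) w : gateaux_differentiable F ->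
  gateaux_derivative F v (t *: w) = t * gateaux_derivative F v w.
Proof.
move=> /(_ v)[_ [lin _]].
have f0 : gateaux_derivative F v 0 = 0.
  by have := lin (-1) 0 0; rewrite scaler0 addr0 mulN1r addNr.
by have := lin t w 0; rewrite f0 !addr0.
Qed.

Lemma gateaux_derivativeD F v w1 w2 : gateaux_differentiable F ->
  gateaux_derivative F v (w1 + w2) =
  gateaux_derivative F v w1 + gateaux_derivative F v w2.
Proof.
move=> /(_ v)[_ [lin _]]; have := lin 1 w1 w2.
by rewrite scale1r => ->; rewrite mul1r.
Qed.

Lemma gateaux_derivative_sum (N : nat) F v (ws : 'I_N -> V) :
  gateaux_differentiable F ->
  gateaux_derivative F v (\sum_j ws j) =
  \sum_j gateaux_derivative F v (ws j).
Proof.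
move=> dF; elim/big_rec2: _ => [|j x y _ <-]; last exact: gateaux_derivativeD.
by have := gateaux_derivativeZ v 0 0 dF; rewrite scale0r mul0r.
Qed.

(** [F] is constant along the kernel, so kernel directions may be added to a
    correction without changing the first-order term. *)
Lemma gateaux_derivative_ker F sn v phi : semicoercive F sn ->
  ker_seminorm sn phi -> gateaux_derivative F v phi = 0.
Proof.
move=> [[[_ snZ] _] _ Fker _] phi0.
rewrite /gateaux_derivative /derive.
rewrite (_ : (fun h : R => _) = cst 0) ?lim_cst//.
apply/funext => h/=; rewrite [h *: phi + v]addrC -(Fker v) ?subrr ?scaler0//.
by rewrite /ker_seminorm/= snZ phi0 mulr0.
Qed.

Lemma local_distance_ge0 F v w : gateaux_differentiable F ->
  convex_function [set: V] F -> 0 <= local_distance F w v.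
Proof.
move=> dF cF; rewrite subr_ge0; apply: gateaux_le_increment => //.
by have [] := dF v.
Qed.

Lemma local_distance0 F v : gateaux_differentiable F ->
  local_distance F 0 v = 0.
Proof.
move=> dF; rewrite /local_distance /local_functional addr0 subrr.
by have := gateaux_derivativeZ v 0 0 dF; rewrite scale0r mul0r => ->; rewrite subr0.
Qed.

Lemma seminorm0 sn : seminorm sn -> sn 0 = 0.
Proof. by case=> _ /(_ 0 0); rewrite scale0r normr0 mul0r. Qed.

Lemma seminormN sn v : seminorm sn -> sn (- v) = sn v.
Proof. by case=> _ snZ; rewrite -scaleN1r snZ normrN1 mul1r. Qed.

Lemma seminorm_ge0 sn v : seminorm sn -> 0 <= sn v.
Proof.
move=> semi; have [/(_ v (- v))+ _] := semi.
by rewrite subrr seminorm0// seminormN//; lra.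
Qed.

Lemma convex_sublevel F c : convex_function [set: V] F ->
  convex_subset (sublevel F c).
Proof.
move=> cF x y t; rewrite !inE => xK yK.
have t0 : 0 <= t%:num by [].
have t1 : t%:num <= 1 by [].
rewrite /sublevel/=; apply: le_trans (convex_functionP x y cF t0 t1) _.
by rewrite /sublevel/= in xK yK; nra.
Qed.

Lemma sublevel_bounded F sn c : semicoercive F sn ->
  seminorm_bounded sn (sublevel F c).
Proof.
move=> [_ _ _ /(_ (c + 1))[M HM]]; exists M => v vK.
by rewrite leNgt; apply/negP => /ltW/HM; rewrite /sublevel/= in vK; lra.
Qed.

End GateauxConvex.

(** * One step of the parallel subspace correction method *)

Section OneStep.
Context {R : realType} {V : normedModType R} {N : nat}.
Implicit Types (F sn : V -> R) (v w : V) (Vs : 'I_N -> set V).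

(** The point reached with the smaller step lies on the segment between [v] and
    the point reached with step [tau0]. *)
Lemma admissible_step_le F Vs tau tau0 : convex_function [set: V] F ->
  admissible_step F Vs tau0 -> 0 < tau -> tau <= tau0 ->
  admissible_step F Vs tau.
Proof.
move=> cF [tau00 adm] t0 tt; split=> // v ws wsV.
pose l := tau / tau0.
have l0 : 0 <= l by rewrite divr_ge0 ?ltW.
have l1 : l <= 1 by rewrite ler_pdivrMr// mul1r.
have taul : tau = l * tau0 by rewrite divfK// gt_eqF.
have := convex_functionP (v + tau0 *: \sum_j ws j) v cF l0 l1.
rewrite scalerDr scalerA -taul addrAC -scalerDl [l + _]addrC subrK scale1r.
move=> /le_trans; apply.
rewrite (_ : _ + tau * _ = l * ((1 - tau0 * N%:R) * F v +
   tau0 * \sum_j F (v + ws j)) + (1 - l) * F v); last by rewrite taul; ring.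
by rewrite lerD2r ler_wpM2l// adm.
Qed.

(** Each exact local solve does at least as well as any competitor in the same
    subspace. *)
Lemma parallel_step_le F Vs tau v ws ws' : admissible_step F Vs tau ->
  (forall j, local_minimizer F Vs v j (ws j)) -> subspace_family Vs ws' ->
  F (v + tau *: \sum_j ws j) <= F v + tau * \sum_j (F (v + ws' j) - F v).
Proof.
move=> [t0 adm] wsmin wsV'.
rewrite (le_trans (adm _ _ _))//; first by move=> j; have [] := wsmin j.
rewrite sumrB sumr_const card_ord.
rewrite (_ : F v + _ = (1 - tau * N%:R) * F v + tau * \sum_j F (v + ws' j)).
  by rewrite lerD2l ler_wpM2l ?(ltW t0)// ler_sum// => j _; have [_] := wsmin j; apply.
by rewrite -mulr_natr; ring.
Qed.

(** A lower bound for every admissible decomposition, hence for the infimum: the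
    first-order terms of the pieces add up to [F'(v) w], since the kernel part
    contributes nothing.  In this form the infimum need not be attained. *)
Lemma parallel_step_energy F sn Vs tau v ws w : gateaux_differentiable F ->
  semicoercive F sn -> admissible_step F Vs tau ->
  (forall j, local_minimizer F Vs v j (ws j)) ->
  (((F (v + tau *: \sum_j ws j) - F v) / tau - gateaux_derivative F v w)%:E <=
   decomposition_energy F sn Vs v w)%E.
Proof.
move=> dF scF adm wsmin; have t0 : 0 < tau by case: adm.
apply: le_ereal_inf_tmp => _ [phi kphi <-].
apply: le_ereal_inf_tmp => _ [ws' [wsV' sumws'] <-].
rewrite lee_fin.
have -> : \sum_j local_distance F (ws' j) v =
    \sum_j (F (v + ws' j) - F v) - gateaux_derivative F v w.
  rewrite sumrB -gateaux_derivative_sum// sumws' gateaux_derivativeD//.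
  by rewrite (gateaux_derivative_ker _ scF kphi) addr0.
rewrite lerD2r ler_pdivrMr// lerBlDl [_ * tau]mulrC.
exact: (parallel_step_le adm).
Qed.

Lemma decomposition_energy_ge0 F sn Vs v w : gateaux_differentiable F ->
  convex_function [set: V] F -> (0 <= decomposition_energy F sn Vs v w)%E.
Proof.
move=> dF cF; apply: le_ereal_inf_tmp => _ [phi _ <-].
apply: le_ereal_inf_tmp => _ [ws _ <-].
by rewrite lee_fin sumr_ge0// => j _; exact: local_distance_ge0.
Qed.

(** The convention for quotients matters when [sn w = 0]: a positive energy would
    give the quotient [+oo], which a finite constant excludes. *)
Lemma decomposition_energy_le F sn Vs (q c : R) (K : set V) v w :
  gateaux_differentiable F -> convex_function [set: V] F ->
  0 < q -> stability_constant F sn Vs q K = c%:E -> K v -> K (v + w) ->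
  (decomposition_energy F sn Vs v w <= (c / q * sn w `^ q)%:E)%E.
Proof.
move=> dF cF q0 Cc Kv Kvw.
have E0 := decomposition_energy_ge0 sn Vs v w dF cF.
set E := decomposition_energy _ _ _ _ _ in E0 *.
have : (q%:E * quotient_sup E (sn w `^ q)%:E <= c%:E)%E.
  rewrite -Cc lee_pmul2l// ?lte_fin//.
  by apply: ereal_sup_ubound; exists v, w.
rewrite /quotient_sup /quotient_with.
have [s0|s0] := eqVneq (sn w `^ q) 0.
  rewrite s0 eqxx andbT; case: ifPn => [/eqP -> _|En0].
    by rewrite mulr0.
  have {}E0 : (0 < E)%E by rewrite lt_neqAle eq_sym En0 E0.
  by rewrite inve0 (gt0_muley E0) gt0_muley ?lte_fin.
have spos : 0 < sn w `^ q by rewrite lt_neqAle eq_sym s0 powR_ge0.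
rewrite eqe (negPf s0) andbF inver (negPf s0).
case: E E0 => [e| |] //.
  by rewrite -!EFinM !lee_fin mulrA ler_pdivrMr// mulrC -ler_pdivlMr// mulrAC.
by rewrite mulyr gtr0_sg ?invr_gt0// mul1e gt0_muley ?lte_fin.
Qed.

(** The correction [w = t (u - v)] stays in the sublevel set by convexity, so the
    stability constant applies to it. *)
Lemma parallel_step_decrease (F sn : V -> R) (Vs : 'I_N -> set V) (u v : V)
    (ws : 'I_N -> V) (q tau c c0 t : R) :
  gateaux_differentiable F -> convex_function [set: V] F ->
  semicoercive F sn -> minimizer F u -> 1 < q ->
  admissible_step F Vs tau ->
  stability_constant F sn Vs q (sublevel F c0) = c%:E ->
  sublevel F c0 v ->
  (forall j, local_minimizer F Vs v j (ws j)) ->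
  0 <= t -> t <= 1 ->
  F (v + tau *: \sum_j ws j) - F u <=
  F v - F u - tau * (t * (F v - F u) - t `^ q * (c / q * sn (v - u) `^ q)).
Proof.
move=> dF cF scF minu q1 adm CE Kv wsmin t0 t1.
have tau0 : 0 < tau by case: adm.
have semi : seminorm sn by case: scF => [[]].
pose w := t *: (u - v).
have Kvw : sublevel F c0 (v + w).
  have -> : v + w = t *: u + (1 - t) *: v.
    by rewrite /w scalerBr scalerBl scale1r addrCA addrA.
  rewrite /sublevel/= in Kv *.
  apply: le_trans (convex_functionP u v cF t0 t1) _.
  by have := minu v; nra.
have snw : sn w `^ q = t `^ q * sn (v - u) `^ q.
  have snE : sn w = t * sn (v - u).
    by rewrite /w -opprB scalerN seminormN// semi.2 ger0_norm.
  rewrite snE powRM//; exact: seminorm_ge0.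
have := le_trans (parallel_step_energy (v := v) w dF scF adm wsmin)
  (decomposition_energy_le dF cF (lt_trans ltr01 q1) CE Kv Kvw).
rewrite lee_fin snw /w gateaux_derivativeZ//.
have dec : gateaux_derivative F v (u - v) <= F u - F v.
  have dvu : derivable F v (u - v) by case: (dF v).
  by have := gateaux_le_increment cF dvu; rewrite [v + _]addrC subrK.
rewrite lerBlDr ler_pdivrMr// => le1.
have : t * gateaux_derivative F v (u - v) <= t * (F u - F v) by rewrite ler_wpM2l.
move=> /(ler_wpM2r (ltW tau0)) le2.
by rewrite mulrDl in le1; lra.
Qed.

End OneStep.

(** * Stable decompositions *)

Section StableDecomposition.
Context {R : realType} {V : completeNormedModType R} {N : nat}.
Implicit Types (v w : V) (Vs : 'I_N -> set V) (ws : 'I_N -> V).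

Lemma subspace_family0 Vs : space_decomposition Vs ->
  subspace_family Vs (fun=> 0).
Proof. by move=> [H _] j; have [[]] := H j; rewrite inE. Qed.

Lemma subspaceD Vs j (a : R) v w : space_decomposition Vs ->
  Vs j v -> Vs j w -> Vs j (a *: v + w).
Proof.
move=> [H _] vV wV; have [[_ lin] _] := H j.
by have := lin a v w; rewrite !inE; apply.
Qed.

Lemma subspace_familyZ Vs (a : R) ws : space_decomposition Vs ->
  subspace_family Vs ws -> subspace_family Vs (fun j => a *: ws j).
Proof.
move=> dV wsV j.
by have := subspaceD a dV (wsV j) (subspace_family0 dV j); rewrite addr0.
Qed.

Definition bounded_sums Vs (M : R) : set V :=
  [set v | exists2 ws, subspace_family Vs ws /\ (forall j, `|ws j| <= M) &
                       v = \sum_j ws j].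

(** By Baire: the sets [bounded_sums Vs n] cover the space, so the closure of one
    of them has an interior point. *)
Lemma closure_bounded_sums_ball Vs : space_decomposition Vs ->
  exists (n : nat) (x : V) (r : R), 0 < r /\
    ball x r `<=` closure (bounded_sums Vs n%:R).
Proof.
move=> dV.
pose O n := ~` closure (bounded_sums Vs n%:R).
have O_open n : open (O n) by apply: closed_openC; exact: closed_closure.
have capO0 : \bigcap_n O n = set0.
  rewrite -subset0 => v Ov.
  have [ws wsV vE] := dV.2 v.
  pose m : R := \sum_j `|ws j|.
  apply: (Ov (Num.truncn m).+1 I); apply: subset_closure.
  exists ws => //; split=> // j.
  apply: (@le_trans _ _ m); last exact/ltW/truncnS_gt.
  by rewrite /m (bigD1 j)//= lerDl sumr_ge0.
have [n nd] : exists n, ~ dense (O n).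
  apply: contrapT => /forallNP alld.
  have : dense (\bigcap_n O n).
    by apply: Baire => n; split=> //; apply: contrapT; exact: alld.
  rewrite capO0 => /(_ setT); case.
  - by exists 0.
  - exact: openT.
  - by move=> x [].
move: nd => /denseNE[D [[x Dx] DO]].
have /nbhs_ballP[r r0 xrD] := open_nbhs_nbhs Dx.
exists n, x, r; split=> // y /xrD Dy; apply: contrapT => yO.
by have : (D `&` O n) y by []; rewrite DO.
Qed.

(** Subtracting approximations of two points of the ball, [x + a v] and [x],
    moves the ball to the origin; rescaling by [a] makes the bound and the error
    proportional to the norm of [v]. *)
Lemma approximate_decomposition Vs : space_decomposition Vs ->
  exists2 M : R, 0 <= M & forall v, exists ws,
    [/\ subspace_family Vs ws, forall j, `|ws j| <= M * `|v| &
        `|v - \sum_j ws j| <= 2^-1 * `|v|].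
Proof.
move=> dV; have [n [x [r [r0 xr]]]] := closure_bounded_sums_ball dV.
exists (n%:R * 4 / r); first by rewrite divr_ge0 ?mulr_ge0// ltW.
move=> v; have [->|v0] := eqVneq v 0.
  exists (fun=> 0); split; first exact: subspace_family0.
    by move=> j; rewrite normr0 mulr0.
  by rewrite big1 ?subr0 ?normr0 ?mulr0.
have nv0 : 0 < `|v| by rewrite normr_gt0.
pose a := r / (2 * `|v|); have a0 : 0 < a by rewrite divr_gt0 ?mulr_gt0.
(* Two errors of size [e] must add up to half of the norm of [a *: v], that is
   to [r / 4]. *)
pose e := r / 8; have e0 : 0 < e by rewrite divr_gt0.
have close y : ball x r y -> exists2 ws,
    subspace_family Vs ws /\ (forall j, `|ws j| <= n%:R) &
    `|y - \sum_j ws j| < e.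
  move=> /xr /(_ (ball y e) (nbhsx_ballx _ _ e0))[_ [[ws Hws ->]]].
  by rewrite -ball_normE => He; exists ws.
have [ws1 [ws1V b1] c1] : exists2 ws,
    subspace_family Vs ws /\ (forall j, `|ws j| <= n%:R) &
    `|x + a *: v - \sum_j ws j| < e.
  apply: close; rewrite -ball_normE /ball_/= opprD addrA subrr add0r normrN.
  rewrite normrZ gtr0_norm// /a.
  have -> : r / (2 * `|v|) * `|v| = r / 2 by field; rewrite gt_eqF.
  by lra.
have [ws2 [ws2V b2] c2] := close x (ballxx x r0).
exists (fun j => a^-1 *: (-1 *: ws2 j + ws1 j)); split.
- by apply: subspace_familyZ => // j; exact: subspaceD.
- move=> j; rewrite normrZ gtr0_norm ?invr_gt0//.
  rewrite ler_pdivrMl//.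
  have -> : a * (n%:R * 4 / r * `|v|) = n%:R + n%:R.
    by rewrite /a; field; rewrite !gt_eqF.
  by rewrite (le_trans (ler_normD _ _))// scaleN1r normrN lerD.
- rewrite -scaler_sumr big_split/= -scaler_sumr scaleN1r.
  rewrite -[X in X - _](scalerK (lt0r_neq0 a0)) -scalerBr normrZ.
  rewrite gtr0_norm ?invr_gt0// ler_pdivrMl//.
  have -> : a * (2^-1 * `|v|) = e + e.
    by rewrite /a /e; field; rewrite !gt_eqF.
  rewrite (_ : _ - _ = (x + a *: v - \sum_j ws1 j) - (x - \sum_j ws2 j)).
    by rewrite (le_trans (ler_normB _ _))// lerD// ltW.
  set S1 := \sum_j _; set S2 := \sum_j _.
  rewrite !opprD !opprK -[x + _ - _]addrA [RHS]addrACA subrr add0r -addrA.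
  by congr (_ + _); rewrite addrC.
Qed.

Lemma geometric_series_le (a z : R) n : 0 <= a -> 0 <= z -> z < 1 ->
  series (geometric a z) n <= a / (1 - z).
Proof.
move=> a0 z0 z1; rewrite geometric_seriesE ?lt_eqF//.
rewrite ler_wpM2r ?invr_ge0 ?subr_ge0 ?(ltW z1)//.
by rewrite -{2}(mulr1 a) ler_wpM2l// gerBl exprn_ge0.
Qed.

(** The open mapping theorem for the sum map: iterating the approximate
    decomposition on the successive remainders, the pieces in each subspace form
    a series dominated by a geometric one.  Completeness makes it converge, and
    closedness keeps the limit in the subspace. *)
Lemma stable_decomposition Vs : space_decomposition Vs ->
  exists2 M : R, 0 <= M & forall v, exists ws,
    [/\ subspace_family Vs ws, forall j, `|ws j| <= M * `|v| &
        v = \sum_j ws j].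
Proof.
move=> dV; have [M M0 /choice[g gP]] := approximate_decomposition dV.
exists (2 * M); first by rewrite mulr_ge0.
move=> v; pose y k := iter k (fun x => x - \sum_j g x j) v.
have y_le k : `|y k| <= 2^-1 ^+ k * `|v|.
  elim: k => [|k IH]; first by rewrite expr0 mul1r.
  have [_ _ gy] := gP (y k).
  by rewrite (le_trans gy)// exprS -mulrA ler_wpM2l// invr_ge0.
have half1 : `|2^-1 : R| < 1 by rewrite gtr0_norm ?invr_gt0// invf_lt1 ?ltr1n.
pose s j := series (fun k => g (y k) j).
have g_le j k : `|g (y k) j| <= geometric (M * `|v|) 2^-1 k.
  have [_ gM _] := gP (y k).
  by rewrite (le_trans (gM j))//= -mulrA ler_wpM2l// mulrC.
have s_cvg j : cvgn (s j).
  apply: normed_cvg; apply: series_le_cvg (g_le j) _ => //.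
  - by move=> n; rewrite (le_trans _ (g_le j n)).
  - exact: is_cvg_geometric_series.
have s_le j n : `|s j n| <= 2 * M * `|v|.
  rewrite (le_trans (ler_norm_sum _ _ _))//.
  apply: (@le_trans _ _ (series (geometric (M * `|v|) 2^-1) n)).
    by apply: ler_sum => k _; exact: g_le.
  rewrite (le_trans (geometric_series_le _ _ _ _)) ?mulr_ge0 ?invr_ge0//.
    by rewrite invf_lt1 ?ltr1n.
  by rewrite [leRHS](_ : _ = M * `|v| / (1 - 2^-1))//; field.
exists (fun j => limn (s j)); split.
- move=> j; apply: (closed_cvg (Vs j) (dV.1 j).2) (s_cvg j).
  apply: nearW => n; rewrite /s/series/=.
  elim/big_rec: _ => [|k x _ xV]; first exact: (subspace_family0 dV).
  have [gV _ _] := gP (y k).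
  by have := subspaceD 1 dV (gV j) xV; rewrite scale1r.
- move=> j; rewrite -lim_norm//; apply: limr_le; first exact: is_cvg_norm.
  by apply: nearW => n; exact: s_le.
- have sumE n : \sum_j s j n = v - y n.
    rewrite exchange_big/=; elim: n => [|n IH]; first by rewrite big_geq// subrr.
    have yS : y n.+1 = y n - \sum_j g (y n) j by [].
    by rewrite yS big_nat_recr//= IH opprB -addrA [- _ + _]addrC.
  have y_cvg : y n @[n --> \oo] --> (0 : V).
    apply: norm_cvg0; apply: (@squeeze_cvgr _ _ _ _ (cst 0) (geometric `|v| 2^-1)).
    - by apply: nearW => n /=; rewrite normr_ge0 mulrC y_le.
    - exact: cvg_cst.
    - exact: cvg_geometric.
  apply: (@cvg_unique _ (@norm_hausdorff _ V) ((fun n => \sum_j s j n) @ \oo)).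
    rewrite (_ : (fun n => _) = (fun n => v - y n)); last exact/funext.
    by have := cvgB (cvg_cst v) y_cvg; rewrite subr0; apply.
  by apply: cvg_big => [x|j _]; [exact: add_continuous|exact: s_cvg].
Qed.

End StableDecomposition.

(** * Finiteness of the stability constant *)

Section StabilityConstant.
Context {R : realType} {V : completeNormedModType R} {N : nat}.
Variables (F sn : V -> R) (Vs : 'I_N -> set V) (q : R).
Implicit Types (v w phi : V) (K : set V).
Hypotheses (dF : gateaux_differentiable F) (cF : convex_function [set: V] F).
Hypotheses (scF : semicoercive F sn) (dV : space_decomposition Vs).
Hypotheses (q1 : 1 < q) (smF : local_smoothness F sn Vs q).

Let semi : seminorm sn. Proof. by case: scF => [[]]. Qed.

Lemma convex_subspace_ball (j : 'I_N) (rho : R) :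
  convex_subset [set w | Vs j w /\ `|w| <= rho].
Proof.
move=> x y t; rewrite !inE => -[xV xr] [yV yr].
have t0 : 0 <= t%:num by [].
have t1 : 0 <= 1 - t%:num by rewrite subr_ge0.
split.
  apply: subspaceD => //.
  by have := subspaceD (1 - t%:num) dV yV (subspace_family0 dV j); rewrite addr0.
rewrite (le_trans (ler_normD _ _))// !normrZ/= !ger0_norm//.
rewrite (@le_trans _ _ (t%:num * rho + (1 - t%:num) * rho))//.
  by rewrite lerD// ler_wpM2l.
by rewrite -mulrDl addrC subrK mul1r.
Qed.

(** The bound for [w = 0] has to come from [local_distance0]: there the quotient
    in the smoothness hypothesis is 0/0 and carries no information. *)
Lemma local_smoothness_le K (j : 'I_N) (rho : R) : 0 <= rho ->
  seminorm_bounded sn K -> convex_subset K ->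
  exists2 L : R, 0 <= L & forall v w, K v -> Vs j w -> `|w| <= rho ->
    local_distance F w v <= L * `|w| `^ q.
Proof.
move=> rho0 bK cK; pose Kj : set V := [set w | Vs j w /\ `|w| <= rho].
have bKj : bounded_set Kj.
  exists rho; split; first exact: num_real.
  by move=> M rhoM w [_ /le_trans]; apply; exact: ltW.
have Kj0 : Kj 0.
  by split; [exact: (subspace_family0 dV)|rewrite normr0].
have := @smF j K Kj bK cK (fun w => @proj1 _ _) bKj
  (convex_subspace_ball (rho := rho)) Kj0.
set S := ereal_sup _ => Soo.
exists `|fine S| => // v w Kv Vw wr.
have [->|w0] := eqVneq w 0.
  have q0 : q != 0 by rewrite gt_eqF// (lt_trans ltr01).
  by rewrite (local_distance0 _ dF) normr0 powR0// mulr0.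
have wq0 : 0 < `|w| `^ q by rewrite powR_gt0// normr_gt0.
have : (quotient_sup (local_distance F w v)%:E (`|w| `^ q)%:E <= S)%E.
  by apply: ereal_sup_ubound; exists v, w.
rewrite /quotient_sup/quotient_with [((_ `^ _)%:E == 0)%E]eqe (gt_eqF wq0) andbF.
rewrite inver (gt_eqF wq0) -EFinM.
case: S Soo => [s| |] //= _; rewrite lee_fin ler_pdivrMr// => /le_trans; apply.
by rewrite ler_wpM2r ?ler_norm// ltW.
Qed.

(** The factor [2 * C'] absorbs the infimum not being attained, which is possible
    as long as [sn w] is positive. *)
Lemma kernel_shift_le : exists2 c : R, 0 <= c & forall w, 0 < sn w ->
  exists2 phi, ker_seminorm sn phi & `|w + phi| <= c * sn w.
Proof.
have [_ [C' C'0 HC'] _ _] := scF.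
exists (2 * C'); first by rewrite mulr_ge0// ltW.
move=> w w0; have e0 : 0 < C' * sn w by rewrite mulr_gt0.
have hi : has_inf [set `|w + phi| | phi in ker_seminorm sn].
  split; first by exists `|w + 0|; exists 0 => //; exact: seminorm0.
  by exists 0 => _ [phi _ <-].
have [_ [phi kphi <-] lt_phi] := inf_adherent e0 hi.
exists phi => //; apply: ltW; apply: (lt_le_trans lt_phi).
by have := HC' w; lra.
Qed.

(** For [sn w > 0] the pieces of a stable decomposition of a kernel shift of [w]
    have norm at most [M * c * sn w], which is bounded on [K], so local smoothness
    bounds the energy by a multiple of [sn w ^ q].  For [sn w = 0] the shift
    [phi = - w] makes the energy vanish. *)
Lemma stability_constant_fin K : seminorm_bounded sn K -> convex_subset K ->
  K !=set0 -> exists2 c : R, 0 <= c & stability_constant F sn Vs q K = c%:E.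
Proof.
move=> bK cK [x Kx]; have q0 : 0 < q := lt_trans ltr01 q1.
have [B KB] := bK.
have [M M0 decM] := stable_decomposition dV.
have [c c0 kerc] := kernel_shift_le.
have B0 : 0 <= B by rewrite (le_trans (seminorm_ge0 x semi))// KB.
(* [sn w <= 2 * B] when [v] and [v + w] both belong to [K]. *)
pose rho := M * (c * (2 * B)).
have rho0 : 0 <= rho by rewrite !mulr_ge0.
have /choice[L HL] : forall j : 'I_N, exists L : R, 0 <= L /\
    forall v w, K v -> Vs j w -> `|w| <= rho ->
    local_distance F w v <= L * `|w| `^ q.
  by move=> j; have [L L0 HL] := local_smoothness_le j rho0 bK cK; exists L.
pose A := (\sum_j L j) * (M * c) `^ q.
have sup_le v w : K v -> K (v + w) ->
    (quotient_sup (decomposition_energy F sn Vs v w) (sn w `^ q)%:E <= A%:E)%E.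
  move=> Kv Kvw; have E0 := decomposition_energy_ge0 sn Vs v w dF cF.
  have A0 : 0 <= A.
    by rewrite mulr_ge0 ?powR_ge0// sumr_ge0// => j _; have [] := HL j.
  have [w0|w0] := eqVneq (sn w) 0.
    have -> : decomposition_energy F sn Vs v w = 0%E.
      apply/eqP; rewrite eq_le E0 andbT.
      apply: ge_ereal_inf; exists (ereal_inf [set
        (\sum_j local_distance F (ws j) v)%:E | ws in [set ws |
          subspace_family Vs ws /\ \sum_j ws j = w - w]]).
        by exists (- w) => //; rewrite /ker_seminorm/= seminormN.
      apply: ge_ereal_inf; exists 0%E => //; exists (fun=> 0).
        by split; [exact: subspace_family0|rewrite subrr big1].
      by rewrite big1// => j _; exact: (local_distance0 _ dF).
    by rewrite w0 powR0 ?gt_eqF// /quotient_sup/quotient_with eqxx lee_fin.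
  have {}w0 : 0 < sn w by rewrite lt_neqAle eq_sym w0 (seminorm_ge0 w semi).
  have wq0 : 0 < sn w `^ q by rewrite powR_gt0.
  have snw : sn w <= 2 * B.
    have [[[snD _] _] _ _ _] := scF.
    have := snD (v + w) (- v); rewrite addrAC subrr add0r (seminormN v semi).
    by have := KB _ Kv; have := KB _ Kvw; lra.
  have [phi kphi wphi] := kerc w w0.
  have [ws [wsV wsM wsE]] := decM (w + phi).
  have ws_le j : `|ws j| <= M * c * sn w.
    by rewrite (le_trans (wsM j))// -mulrA ler_wpM2l.
  have E_le : (decomposition_energy F sn Vs v w <= (A * sn w `^ q)%:E)%E.
    apply: ge_ereal_inf; exists (ereal_inf [set
      (\sum_j local_distance F (ws j) v)%:E | ws in [set ws |
        subspace_family Vs ws /\ \sum_j ws j = w + phi]]); first by exists phi.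
    apply: ge_ereal_inf; exists (\sum_j local_distance F (ws j) v)%:E.
      by exists ws.
    rewrite lee_fin /A -mulrA -powRM ?mulr_ge0 ?(ltW w0)// mulr_suml ler_sum// => j _.
    have [Lj0 HLj] := HL j.
    rewrite (le_trans (HLj v (ws j) Kv (wsV j) _))//.
      by rewrite (le_trans (ws_le j))// /rho -mulrA ler_wpM2l// ler_wpM2l.
    by rewrite ler_wpM2l// ge0_ler_powR ?nnegrE ?mulr_ge0 ?(ltW q0) ?(ltW w0).
  rewrite /quotient_sup/quotient_with [((_ `^ _)%:E == 0)%E]eqe (gt_eqF wq0) andbF.
  by rewrite inver (gt_eqF wq0) lee_pdivrMr.
set Q := ereal_sup [set z | exists v w, [/\ K v, K (v + w) &
  z = quotient_sup (decomposition_energy F sn Vs v w) (sn w `^ q)%:E]].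
have Qle : (Q <= A%:E)%E by apply: ge_ereal_sup => _ [v [w [Kv Kvw ->]]]; exact: sup_le.
have Qge : (0 <= Q)%E.
  apply: (@le_trans _ _ (quotient_sup (decomposition_energy F sn Vs x 0) (sn 0 `^ q)%:E)).
    rewrite /quotient_sup/quotient_with; case: ifP => // _.
    by rewrite mule_ge0 ?inve_ge0 ?lee_fin ?powR_ge0// decomposition_energy_ge0.
  by apply: ereal_sup_ubound; exists x, 0; rewrite addr0.
rewrite /stability_constant -/Q.
case: Q Qle Qge => [r _| |]//; rewrite lee_fin => r0.
by exists (q * r) => //; rewrite mulr_ge0// ltW.
Qed.

End StabilityConstant.

(** * Consequences of sharpness *)

Section Sharpness.
Context {R : realType} {V : normedModType R}.
Implicit Types (F sn : V -> R) (u v : V) (K : set V).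

Lemma sharpness_constant_le F sn u (p m : R) K v : 0 < p -> minimizer F u ->
  sharpness_constant F sn u p K = m%:E -> K v ->
  m * sn (v - u) `^ p <= p * (F v - F u).
Proof.
move=> p0 minu; rewrite /sharpness_constant.
set I := ereal_inf _ => mE Kv.
have : (I <= quotient_inf (F v - F u)%:E (sn (v - u) `^ p)%:E)%E.
  by apply: ereal_inf_lbound; exists v.
case: I mE => [i [<-]| |].
- have [s0 _|s0] := eqVneq (sn (v - u) `^ p) 0.
    by rewrite s0 mulr0 mulr_ge0 ?(ltW p0)// subr_ge0.
  have spos : 0 < sn (v - u) `^ p by rewrite lt_neqAle eq_sym s0 powR_ge0.
  rewrite /quotient_inf/quotient_with [((_ `^ _)%:E == 0)%E]eqe (gt_eqF spos) andbF.
  rewrite inver (gt_eqF spos) lee_fin ler_pdivlMr// => le_i.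
  by rewrite -mulrA ler_wpM2l// ltW.
- by rewrite gt0_muley ?lte_fin.
- by rewrite gt0_muleNy ?lte_fin.
Qed.

(** An infinite constant leaves only quotients of the form 0/0, so [v - u] is in
    the kernel of the seminorm, along which [F] is constant. *)
Lemma sharpness_constant_infinite F sn u (p : R) K v : 0 < p ->
  semicoercive F sn ->
  sharpness_constant F sn u p K = +oo%E -> K v -> F v = F u.
Proof.
move=> p0 scF; rewrite /sharpness_constant.
set I := ereal_inf _ => mE Kv.
have : (I <= quotient_inf (F v - F u)%:E (sn (v - u) `^ p)%:E)%E.
  by apply: ereal_inf_lbound; exists v.
case: I mE => [i| _|]//; last by rewrite gt0_muleNy ?lte_fin.
have [s0 _|s0] := eqVneq (sn (v - u) `^ p) 0.
  have [_ _ Fker _] := scF.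
  rewrite [RHS](Fker u (v - u)) ?[u + _]addrC ?subrK//.
  by apply/eqP; move: s0 => /eqP; rewrite powR_eq0 => /andP[].
have spos : 0 < sn (v - u) `^ p by rewrite lt_neqAle eq_sym s0 powR_ge0.
rewrite /quotient_inf/quotient_with [((_ `^ _)%:E == 0)%E]eqe (gt_eqF spos) andbF.
by rewrite inver (gt_eqF spos).
Qed.

End Sharpness.

(** * Recursions for the energy error *)

Section ScalarRecursions.
Context {R : realType}.
Implicit Types (q b c s t z : R).

Lemma powR_pred q t : 0 < q -> 0 <= t -> t `^ q = t * t `^ (q - 1).
Proof.
move=> q0; rewrite le_eqVlt => /orP[/eqP<-|t0].
  by rewrite powR0 ?mul0r// gt_eqF.
rewrite -{2}(powRr1 (ltW t0)) -powRD; last by rewrite (gt_eqF t0) implybT.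
by congr (_ `^ _); ring.
Qed.

(** The condition on [t] makes the loss [t ^ q * (c / q) * s ^ q] at most the
    fraction [1 / q] of the gain [t * z].  When [c * s ^ q = b * z], the difference
    is maximal exactly where the condition is an equality. *)
Lemma step_decrease q b c s t z : 1 < q -> 0 <= z -> 0 <= t ->
  t `^ (q - 1) * b <= 1 -> c * s `^ q <= b * z ->
  t * ((1 - 1 / q) * z) <= t * z - t `^ q * (c / q * s `^ q).
Proof.
move=> q1 z0 t0 tb csz; have q0 : 0 < q by lra.
rewrite powR_pred// -[t * _ * _]mulrA -mulrBr ler_wpM2l// div1r mulrBl mul1r.
rewrite lerD2l lerN2.
have -> : t `^ (q - 1) * (c / q * s `^ q) = q^-1 * (t `^ (q - 1) * (c * s `^ q)).
  by ring.
rewrite ler_wpM2l ?invr_ge0 ?(ltW q0)//.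
apply: (le_trans (ler_wpM2l (powR_ge0 t (q - 1)) csz)); rewrite mulrA.
by rewrite -{2}(mul1r z) ler_wpM2r.
Qed.

(** A negative ratio forces the sequence to vanish, so [r] may have any sign. *)
Lemma geometric_decay (r : R) (z : nat -> R) : (forall n, 0 <= z n) ->
  (forall n, z n.+1 <= r * z n) -> forall n, z n <= r ^+ n * z 0%N.
Proof.
move=> z0 zS; have [r0|r0] := leP 0 r.
  elim=> [|n IH]; first by rewrite expr0 mul1r.
  by rewrite (le_trans (zS n))// exprS -mulrA ler_wpM2l.
have zn n : z n = 0.
  apply/eqP; rewrite eq_le z0 andbT.
  by rewrite -(nmulr_rge0 _ r0) (le_trans _ (zS n)).
by move=> n; rewrite !zn mulr0.
Qed.

Lemma powR_invK (b x : R) : 0 < b -> 0 <= x -> (x `^ (1 / b)) `^ b = x.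
Proof. by move=> b0 x0; rewrite -powRrM div1r mulVf ?gt_eqF// powRr1. Qed.

(** The discrete analogue of [z' = - kappa * z ^ (1 + 1 / b)], whose solutions have
    [z ^ (- 1 / b)] growing linearly with slope [kappa / b].  With
    [y = z ^ (1 / b)], the bound [1 - x <= exp (- x)] yields
    [y (n+1) * (1 + kappa / b * y n) <= y n], i.e. [1 / y] grows by at least
    [kappa / b] at each step. *)
Lemma sublinear_decay (kappa b : R) (z : nat -> R) : 0 < kappa -> 0 < b ->
  (forall n, 0 <= z n) -> 0 < z 0%N ->
  (forall n, z n.+1 <= z n - kappa * z n `^ (1 / b) * z n) ->
  let C := (b / kappa) `^ b in
  forall n, z n <= C / (n%:R + (C / z 0%N) `^ (1 / b)) `^ b.
Proof.
move=> k0 b0 z0 z00 zS C.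
pose y n := z n `^ (1 / b).
pose a n := (y 0%N)^-1 + n%:R * (kappa / b).
have kb0 : 0 < kappa / b by rewrite divr_gt0.
have y0 n : 0 <= y n by exact: powR_ge0.
have y00 : 0 < y 0%N by exact: powR_gt0.
have a0 n : 0 < a n by rewrite ltr_wpDr ?invr_gt0// mulr_ge0// ltW.
have yS n : y n.+1 * (1 + kappa / b * y n) <= y n.
  have zexp : z n.+1 <= z n * expR (- (kappa * y n)).
    rewrite (le_trans (zS n))// -/(y n) mulrC -{1}(mulr1 (z n)) mulrC.
    rewrite (_ : _ - _ = z n * (1 + - (kappa * y n))); last by ring.
    by rewrite ler_wpM2l// expR_ge1Dx.
  have yexp : y n.+1 <= y n * expR (- (kappa / b * y n)).
    have -> : - (kappa / b * y n) = - (kappa * y n) * (1 / b) by ring.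
    rewrite expRM -powRM ?expR_ge0//.
    by rewrite ge0_ler_powR ?nnegrE ?mulr_ge0 ?expR_ge0// invr_ge0 ltW.
  rewrite (le_trans (ler_wpM2r _ yexp))//.
    by rewrite addr_ge0// mulr_ge0// ltW.
  rewrite -[leRHS]mulr1 -[_ * expR _ * _]mulrA ler_wpM2l// expRN.
  by rewrite ler_pdivrMl ?expR_gt0// mulr1 expR_ge1Dx.
(* [a n <= 1 / y n], stated without division since [y n] may vanish. *)
have ay n : a n * y n <= 1.
  elim: n => [|n IH]; first by rewrite /a mul0r addr0 mulVf// gt_eqF.
  have [yn0|yn0] := eqVneq (y n) 0.
    have := yS n; rewrite yn0 mulr0 addr0 mulr1 => yn1.
    by rewrite (le_trans _ ler01)// mulr_ge0_le0// ltW.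
  have {yn0}yn0 : 0 < y n by rewrite lt_neqAle eq_sym yn0 y0.
  have aS : a n.+1 * y n <= 1 + kappa / b * y n.
    have -> : a n.+1 * y n = a n * y n + kappa / b * y n by rewrite /a -natr1; ring.
    by rewrite lerD2r.
  rewrite -(ler_pM2r yn0) mul1r (le_trans _ (yS n))// mulrAC mulrC.
  by rewrite ler_wpM2l.
move=> n.
have Cinv : (C / z 0%N) `^ (1 / b) = b / kappa / y 0%N.
  rewrite powRM ?invr_ge0 ?powR_ge0// -powRrM [b * (1 / b)]mulrC div1r mulVf ?gt_eqF//.
  rewrite powRr1 ?divr_ge0 ?(ltW b0) ?(ltW k0)// -[in (z 0%N)^-1]powR_inv1 ?(ltW z00)//.
  by rewrite powRAC powR_inv1 ?powR_ge0// /y div1r.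
have -> : n%:R + (C / z 0%N) `^ (1 / b) = b / kappa * a n.
  by rewrite Cinv /a; field; rewrite !gt_eqF.
rewrite powRM ?divr_ge0 ?(ltW b0) ?(ltW k0) ?(ltW (a0 n))// -/C invfM mulrA.
rewrite divff ?mul1r; last by rewrite gt_eqF// powR_gt0// divr_gt0.
rewrite -(powR_invK b0 (z0 n)) -/(y n) -div1r ler_pdivlMr ?powR_gt0//.
rewrite -powRM ?(ltW (a0 n))// mulrC.
have <- : 1 `^ b = 1 :> R by rewrite powR1.
rewrite ge0_ler_powR ?nnegrE ?(ltW b0)//.
by rewrite mulr_ge0// ltW.
Qed.

End ScalarRecursions.

Section Rates.
Context {R : realType}.
Variables (q tau c : R) (z s : nat -> R).
Hypotheses (q1 : 1 < q) (tau0 : 0 < tau) (c0 : 0 <= c).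
Hypothesis z0 : forall n, 0 <= z n.
Hypothesis step : forall n (t : R), 0 <= t -> t <= 1 ->
  z n.+1 <= z n - tau * (t * z n - t `^ q * (c / q * s n `^ q)).

Let q0 : 0 < q. Proof. exact: lt_trans ltr01 q1. Qed.
Let q10 : 0 < q - 1. Proof. by rewrite subr_gt0. Qed.

Lemma step_decrease_le n b t : 0 <= t -> t <= 1 ->
  t `^ (q - 1) * b <= 1 -> c * s n `^ q <= b * z n ->
  z n.+1 <= z n - tau * (t * ((1 - 1 / q) * z n)).
Proof.
move=> t0 t1 tb cs; apply: (le_trans (step n t0 t1)).
by rewrite lerD2l lerN2 ler_wpM2l ?(ltW tau0)// (step_decrease _ (z0 n) t0 tb).
Qed.

(** Here [T ^ (1 / (q - 1))] is the step parameter [t], so that the condition on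
    [T] is the one on [t] in [step_decrease]. *)
Lemma linear_rate (m T : R) : 0 < m ->
  (forall n, m * s n `^ q <= q * z n) ->
  0 <= T -> T <= 1 -> T * (c * q / m) <= 1 ->
  forall n, z n <= (1 - tau * (1 - 1 / q) * T `^ (1 / (q - 1))) ^+ n * z 0%N.
Proof.
move=> m0 sz T0 T1 Tb; apply: geometric_decay => // n.
have q1i : 0 <= 1 / (q - 1) by rewrite divr_ge0// ltW.
have t1 : T `^ (1 / (q - 1)) <= 1.
  have := ge0_ler_powR q1i T0 ler01 T1.
  by rewrite !powR1.
apply: le_trans (step_decrease_le (powR_ge0 _ _) t1 (b := c * q / m) _ _) _.
- by rewrite powR_invK.
- rewrite (_ : c * q / m * z n = c * (q * z n / m)); last by ring.
  by rewrite ler_wpM2l// ler_pdivlMr// mulrC.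
- by rewrite le_eqVlt; apply/orP; left; apply/eqP; ring.
Qed.

Variables (p m : R).
Hypotheses (qp : q < p) (m0 : 0 < m).
Hypothesis sharp : forall n, m * s n `^ p <= p * z n.

Let p0 : 0 < p. Proof. exact: lt_trans q0 qp. Qed.
Let pq0 : 0 < p - q. Proof. by rewrite subr_gt0. Qed.
Let pm0 : 0 <= p / m. Proof. by rewrite divr_ge0 ?(ltW p0) ?(ltW m0). Qed.
Let A := c * (p / m) `^ (q / p).
Let thr := (p / m) `^ (q / (p - q)) * c `^ (p / (p - q)).
Let A0 : 0 <= A. Proof. by rewrite mulr_ge0 ?powR_ge0. Qed.
Let e := (p - q) / p.
Let e0 : 0 < e. Proof. by rewrite divr_gt0. Qed.

(** For positive [A], the threshold is the value of [z n] at which [b n], defined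
    below, equals [1]: there the optimal step parameter is exactly [1]. *)
Let thrE : thr = A `^ (1 / e).
Proof.
rewrite /A powRM ?powR_ge0// -powRrM mulrC /e /thr.
by congr (_ `^ _ * _ `^ _); field; rewrite !gt_eqF.
Qed.

Let thrK : thr `^ e = A.
Proof. by rewrite thrE powR_invK. Qed.

Let cs_le n : c * s n `^ q <= A * z n `^ (q / p).
Proof.
rewrite /A -mulrA ler_wpM2l// -powRM//.
have -> : s n `^ q = (s n `^ p) `^ (q / p).
  by rewrite -powRrM mulrC divfK// gt_eqF.
have qp0 : 0 <= q / p by rewrite divr_ge0 ?(ltW q0) ?(ltW p0).
apply: ge0_ler_powR; rewrite ?nnegrE ?powR_ge0 ?(mulr_ge0 pm0)//.
by rewrite mulrAC ler_pdivlMr// mulrC.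
Qed.

Let b n := A * z n `^ (- e).

Let bz n : 0 < z n -> c * s n `^ q <= b n * z n.
Proof.
move=> zn; apply: (le_trans (cs_le n)); rewrite /b -mulrA ler_wpM2l//.
rewrite -[X in _ `^ _ * X](powRr1 (ltW zn)) -powRD; last by rewrite (gt_eqF zn) implybT.
by rewrite (_ : - e + 1 = q / p)// /e; field; rewrite gt_eqF.
Qed.

(** Above the threshold [b 0 < 1], and the full step [t = 1] is allowed. *)
Lemma first_step_above_threshold : thr < z 0%N ->
  z 1%N <= (1 - tau * (1 - 1 / q)) * z 0%N.
Proof.
move=> thrz; have zp : 0 < z 0%N.
  by apply: le_lt_trans thrz; rewrite mulr_ge0 ?powR_ge0.
have := step_decrease_le ler01 (lexx 1) (b := b 0%N) _ (bz zp).
rewrite powR1 mul1r => /(_ _) -h; rewrite (le_trans (h _))//; last first.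
  by rewrite le_eqVlt; apply/orP; left; apply/eqP; ring.
rewrite /b powRN ler_pdivrMr ?powR_gt0// mul1r -thrK.
by rewrite ge0_ler_powR ?nnegrE ?(ltW e0) ?(ltW thrz)// thrE powR_ge0.
Qed.

(** Below the threshold [b n >= 1], and the optimal [t = b n ^ (- 1 / (q - 1))] is
    at most [1]; it is proportional to [z n ^ (1 / beta)]. *)
Lemma sublinear_rate : 0 < z 0%N -> z 0%N <= thr ->
  let beta := p * (q - 1) / (p - q) in
  let C := (p * q / ((p - q) * tau)) `^ beta * thr in
  0 < C /\
  forall n, z n <= C / (n%:R + (C / z 0%N) `^ (1 / beta)) `^ beta.
Proof.
move=> zp zthr beta C.
have thr0 : 0 < thr by exact: lt_le_trans zthr.
have Ap : 0 < A by rewrite -thrK powR_gt0.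
have beta0 : 0 < beta by rewrite divr_gt0// mulr_gt0.
have iq0 : 0 < 1 - 1 / q by rewrite subr_gt0 div1r invf_lt1.
pose kappa := tau * (1 - 1 / q) * A `^ (- (1 / (q - 1))).
have kappa0 : 0 < kappa by rewrite !mulr_gt0// powR_gt0.
have zdec n : z n.+1 <= z n.
  have := step n (lexx 0) ler01.
  by rewrite powR0 ?gt_eqF// !mul0r subr0 mulr0 subr0.
have zle n : z n <= z 0%N.
  by elim: n => // n; exact: le_trans.
have zS n : z n.+1 <= z n - kappa * z n `^ (1 / beta) * z n.
  have [zn0|zn0] := eqVneq (z n) 0.
    by have := zdec n; rewrite zn0 mulr0 subr0.
  have znp : 0 < z n by rewrite lt_neqAle eq_sym zn0 z0.
  have bp : 0 < b n by rewrite mulr_gt0// powR_gt0.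
  have b1 : 1 <= b n.
    rewrite /b powRN ler_pdivlMr ?powR_gt0// mul1r -thrK.
    by rewrite ge0_ler_powR ?nnegrE ?(ltW e0) ?(ltW thr0)// (le_trans (zle n)).
  pose t := b n `^ (- (1 / (q - 1))).
  have t1 : t <= 1.
    rewrite /t powRN invf_le1 ?powR_gt0//.
    have := @ge0_ler_powR R (1 / (q - 1)) _ 1 (b n) ler01 (ltW bp) b1.
    by rewrite powR1; apply; rewrite divr_ge0// ltW.
  have t0 : 0 <= t by exact: powR_ge0.
  apply: le_trans (step_decrease_le t0 t1 (b := b n) _ (bz znp)) _.
    rewrite /t -powRrM mulNr div1r mulVf ?gt_eqF// powR_inv1 ?(ltW bp)//.
    by rewrite mulVf ?gt_eqF.
  have -> : t = A `^ (- (1 / (q - 1))) * z n `^ (1 / beta).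
    rewrite /t /b powRM ?powR_ge0// -powRrM; congr (_ * _ `^ _).
    by rewrite /e /beta; field; rewrite !gt_eqF.
  by rewrite le_eqVlt /kappa; apply/orP; left; apply/eqP; ring.
have CE : C = (beta / kappa) `^ beta.
  have -> : beta / kappa = p * q / ((p - q) * tau) * A `^ (1 / (q - 1)).
    rewrite /kappa powRN /beta; field.
    by rewrite !gt_eqF ?powR_gt0.
  rewrite powRM ?powR_ge0//; last by rewrite divr_ge0 ?mulr_ge0// ltW.
  rewrite /C thrE -powRrM; congr (_ * _ `^ _).
  by rewrite /e /beta; field; rewrite !gt_eqF.
have Cp : 0 < C by rewrite CE powR_gt0// divr_gt0.
by split=> // n; rewrite CE; exact: sublinear_decay.
Qed.

End Rates.

(** * The convergence theorem *)

Theorem theorem4p13 (R : realType) (V : completeNormedModType R)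
  (F sn : V -> R) (N : nat) (Vs : 'I_N -> set V) (u : V)
  (p q tau0 tau : R) (us : nat -> V)
  (reflexiveV : reflexive_space V)
  (diffF : gateaux_differentiable F)
  (convexF : convex_function [set: V] F)
  (semicoerciveF : semicoercive F sn)
  (decompV : space_decomposition Vs)
  (min_u : minimizer F u)
  (q_gt1 : 1 < q) (smoothF : local_smoothness F sn Vs q)
  (p_gt1 : 1 < p) (sharpF : sharpness F sn u p)
  (max_tau0 : max_admissible_step F Vs tau0)
  (tau_gt0 : 0 < tau) (tau_le : tau <= tau0)
  (us_gen : parallel_subspace_correction F Vs tau us) :
  let zeta := fun n => F (us n) - F u in
  let K0 := sublevel F (F (us 0%N)) in
  let mu := sharpness_constant F sn u p K0 in
  let CK := stability_constant F sn Vs q K0 in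
  (p = q -> forall n,
     ((zeta n)%:E <=
      (1 - (tau * (1 - 1 / q))%:E *
           (mine 1 (mu / (q%:E * CK))) `^ (1 / (q - 1))) ^+ n * (zeta 0%N)%:E)%E)
  /\
  (q < p ->
   let threshold :=
     ((p%:E / mu) `^ (q / (p - q)) * CK `^ (p / (p - q)))%E in
   let beta := p * (q - 1) / (p - q) in
   let C :=
     (((p * q / ((p - q) * tau)) `^ (p * (q - 1) / (p - q)))%:E *
      (p%:E / mu) `^ (q / (p - q)) * CK `^ (p / (p - q)))%E in
   ((threshold < (zeta 0%N)%:E)%E ->
      zeta 1%N <= (1 - tau * (1 - 1 / q)) * zeta 0%N) /\
   (~ (threshold < (zeta 0%N)%:E)%E -> forall n,
      if zeta 0%N == 0 then zeta n = 0 else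
      ((zeta n)%:E <=
       C / (n%:R%:E + (C / (zeta 0%N)%:E) `^ (1 / beta)) `^ beta)%E)).
Proof.
move=> zeta K0 mu CK.
have p0 : 0 < p := lt_trans ltr01 p_gt1.
have q0 : 0 < q := lt_trans ltr01 q_gt1.
have adm : admissible_step F Vs tau.
  by apply: (@admissible_step_le _ _ _ _ _ _ tau0) => //; case: max_tau0.
have bK0 : seminorm_bounded sn K0 by exact: sublevel_bounded.
have cK0 : convex_subset K0 by exact: convex_sublevel.
have K0u0 : K0 (us 0%N) by rewrite /K0/sublevel/=.
have K0u : K0 u by exact: min_u.
have [c c0 CE] : exists2 c, 0 <= c & CK = c%:E.
  by apply: stability_constant_fin => //; exists u.
have mu0 : (0 < mu)%E by exact: sharpF.
have z0 n : 0 <= zeta n by rewrite subr_ge0.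
pose s n := sn (us n - u).
have semi : seminorm sn by case: semicoerciveF => [[]].
have step_at n t : K0 (us n) -> 0 <= t -> t <= 1 ->
    zeta n.+1 <= zeta n - tau * (t * zeta n - t `^ q * (c / q * s n `^ q)).
  move=> K0n t0 t1; have [ws wsmin usE] := us_gen n.
  rewrite /zeta usE.
  exact: (parallel_step_decrease diffF convexF semicoerciveF min_u q_gt1 adm CE
    K0n wsmin t0 t1).
(* Taking [t = 0] shows that [F] decreases along the iterates. *)
have K0n n : K0 (us n).
  elim: n => // n K0n; have := step_at n 0 K0n (lexx 0) ler01.
  rewrite powR0 ?gt_eqF// !mul0r subr0 mulr0 subr0 lerD2r => /le_trans; apply.
  exact: K0n.
have step n t := step_at n t (K0n n).
have [muy|muNy] := eqVneq mu +oo%E.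
  have zeta0 n : zeta n = 0.
    by apply/eqP; rewrite subr_eq0 (sharpness_constant_infinite p0 _ muy).
  split=> [_ n|pq thr beta C]; first by rewrite !zeta0 mule0.
  by split=> [_|_ n]; rewrite !zeta0 ?mulr0 ?eqxx.
have [m muE] : exists m, mu = m%:E by case: mu mu0 muNy => [m| |] // _ _; exists m.
have m0 : 0 < m by move: mu0; rewrite muE lte_fin.
have sharp n : m * s n `^ p <= p * zeta n by exact: sharpness_constant_le muE (K0n n).
split=> [pq n|qp thr beta C].
- have sharpq k : m * s k `^ q <= q * zeta k by rewrite -pq.
  have [T [T0 T1 Tb TE]] : exists T, [/\ 0 <= T, T <= 1, T * (c * q / m) <= 1 &
      mine 1%E (mu / (q%:E * CK))%E = T%:E].
    rewrite muE CE -EFinM; have [->|cN0] := eqVneq c 0.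
      (* [mu / (q * 0) = +oo], so that the minimum is [1]. *)
      exists 1; split; rewrite ?ler01 ?mul0r ?mulr0 ?ler01//.
      by rewrite inve0 gt0_muley ?lte_fin// min_l ?leey.
    have qc0 : 0 < q * c by rewrite mulr_gt0// lt_neqAle eq_sym cN0.
    exists (Num.min 1 (m / (q * c))); split.
    - by rewrite le_min ler01 divr_ge0// ltW.
    - by rewrite ge_min lexx.
    - rewrite mulrA ler_pdivrMr// mul1r [c * q]mulrC -ler_pdivlMr//.
      by rewrite ge_min lexx orbT.
    - by rewrite inver (gt_eqF qc0) -EFinM EFin_min.
  rewrite TE poweR_EFin -EFinM -EFinB -EFin_expe -EFinM lee_fin.
  exact: (linear_rate q_gt1 tau_gt0 c0 z0 step m0 sharpq).
- have pq0 : 0 < p - q by rewrite subr_gt0.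
  pose rthr := (p / m) `^ (q / (p - q)) * c `^ (p / (p - q)).
  have pmE : (p%:E / mu)%E = (p / m)%:E by rewrite muE inver gt_eqF.
  have thrE : thr = rthr%:E by rewrite /thr pmE CE !poweR_EFin -EFinM.
  rewrite thrE lte_fin; split=> [|/negP].
    exact: (first_step_above_threshold q_gt1 tau_gt0 c0 z0 step qp m0 sharp).
  rewrite -leNgt => zthr n.
  case: ifPn => [/eqP zeta0|zN0].
    apply/eqP; rewrite eq_le z0 andbT -[leRHS]zeta0 lerD2r.
    exact: K0n.
  have zpos : 0 < zeta 0%N by rewrite lt_neqAle eq_sym zN0 z0.
  have [] := sublinear_rate q_gt1 tau_gt0 c0 z0 step qp m0 sharp zpos zthr.
  rewrite -/rthr -/beta.
  set D := _ * rthr => D0 /(_ n) zn.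
  have CD : C = D%:E.
    by rewrite /C pmE CE !poweR_EFin -!EFinM /D/rthr mulrA.
  rewrite CD inver (gt_eqF zpos) -EFinM poweR_EFin inver.
  by rewrite gt_eqF ?powR_gt0 ?ltr_wpDl ?powR_gt0 ?divr_gt0// -EFinM lee_fin.
Qed.
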